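(* Let $f \colon \mathbb{R}^n \to \mathbb{R}$ be a lower semi-continuous function. Then $f$ is Lipschitz at infinity if and only if $\partial^{\infty} f(\infty) = \{0\}$. In this case, $\partial f(\infty)$ is nonempty and compact.
   Context: $\mathbb{R}^n$ carries the Euclidean norm and scalar product; $\mathbb{B}_R$ is the closed ball of radius $R$ centered at the origin. Lipschitz at infinity: $f \colon \mathbb{R}^n \to \mathbb{R}$ is Lipschitz at infinity if there exist constants $L > 0$ and $R > 0$ such that $|f(x) - f(x')| \le L\|x - x'\|$ for all $x, x' \in \mathbb{R}^n \setminus \mathbb{B}_R$. Regular normal cone: for a set $\Omega \subset \mathbb{R}^N$ and $z \in \Omega$, $\widehat{N}_\Omega(z)$ is the set of $\xi \in \mathbb{R}^N$ with $\langle \xi, z' - z\rangle \le o(\|z' - z\|)$ as $z' \to z$, $z' \in \Omega$. Subdifferentials at infinity: for $f \colon \mathbb{R}^n \to \mathbb{R} \cup \{+\infty\}$ with $\mathrm{dom} f := \{x \mid f(x) < \infty\}$ unbounded and $\mathrm{epi} f := \{(x,r) \in \mathbb{R}^n \times \mathbb{R} \mid f(x) \le r\}$, let $N_{\mathrm{epi} f}(\infty_I)$ (with $I = \{1,\dots,n\} \subset \{1,\dots,n+1\}$) be the set of all $\zeta \in \mathbb{R}^{n+1}$ for which there exist $(x_k, r_k) \in \mathrm{epi} f$ with $\|x_k\| \to \infty$ and $\zeta_k \in \widehat{N}_{\mathrm{epi} f}(x_k, r_k)$ with $\zeta_k \to \zeta$. Then $\partial f(\infty) := \{u \in \mathbb{R}^n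 \mid (u,-1) \in N_{\mathrm{epi} f}(\infty_I)\}$ (limiting subdifferential at infinity) and $\partial^\infty f(\infty) := \{u \in \mathbb{R}^n \mid (u,0) \in N_{\mathrm{epi} f}(\infty_I)\}$ (singular subdifferential at infinity). *)

(* Defs.v *)
From HB Require Import structures.
From mathcomp Require Import all_boot all_order all_algebra.
From mathcomp Require Import all_classical all_reals all_analysis.
Import Order.TTheory GRing.Theory Num.Theory.
Import numFieldNormedType.Exports.

Set Implicit Arguments.
Unset Strict Implicit.
Unset Printing Implicit Defensive.

Local Open Scope classical_set_scope.
Local Open Scope ring_scope.

Definition edot (R : realType) (n : nat) (u v : 'rV[R]_n) : R :=
  \sum_(i < n) u ord0 i * v ord0 i.

(* The library norm [`|x|] on ['rV[R]_n] is the sup norm; it induces the same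
   topology as [enorm], so limits, neighbourhoods, lower semicontinuity and
   compactness below are the library's. *)
Definition enorm (R : realType) (n : nat) (u : 'rV[R]_n) : R :=
  Num.sqrt (edot u u).

Definition lipschitz_at_infinity (R : realType) (n : nat)
    (f : 'rV[R]_n -> R) : Prop :=
  exists L : R, exists rad : R, [/\ 0 < L, 0 < rad &
    forall x x' : 'rV[R]_n, rad < enorm x -> rad < enorm x' ->
      `|f x - f x'| <= L * enorm (x - x')].

(* [<xi, z' - z> <= o(|z' - z|)] bounds only the positive part of the scalar
   product, hence the epsilon form. The cone is empty at points outside
   [Omega]. *)
Definition regular_normal_cone (R : realType) (N : nat)
    (Omega : set 'rV[R]_N) (z : 'rV[R]_N) : set 'rV[R]_N :=
  [set xi | Omega z /\
    forall e : R, 0 < e ->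
      \forall z' \near within Omega (nbhs z),
        edot xi (z' - z) <= e * enorm (z' - z)].

(* The point [(x, r)] of R^n x R, seen in R^(n+1). *)
Definition rV_pair (R : realType) (n : nat) (x : 'rV[R]_n) (r : R) :
  'rV[R]_(n + 1) := row_mx x (const_mx r).

Definition epi (R : realType) (n : nat) (f : 'rV[R]_n -> \bar R) :
    set 'rV[R]_(n + 1) :=
  [set z | (f (lsubmx z) <= (rsubmx z ord0 ord0)%:E)%E].

Definition epi_normal_cone_at_infinity (R : realType) (n : nat)
    (f : 'rV[R]_n -> \bar R) : set 'rV[R]_(n + 1) :=
  [set zeta | exists (x_ : nat -> 'rV[R]_n) (r_ : nat -> R)
      (zeta_ : nat -> 'rV[R]_(n + 1)),
    [/\ forall k, epi f (rV_pair (x_ k) (r_ k)),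
        enorm (x_ k) @[k --> \oo] --> +oo,
        forall k, regular_normal_cone (epi f) (rV_pair (x_ k) (r_ k)) (zeta_ k)
      & zeta_ k @[k --> \oo] --> zeta]].

Definition subdiff_at_infinity (R : realType) (n : nat)
    (f : 'rV[R]_n -> \bar R) : set 'rV[R]_n :=
  [set u | epi_normal_cone_at_infinity f (rV_pair u (-1))].

Definition singular_subdiff_at_infinity (R : realType) (n : nat)
    (f : 'rV[R]_n -> \bar R) : set 'rV[R]_n :=
  [set u | epi_normal_cone_at_infinity f (rV_pair u 0)].

(* Main.v *)
Require Import Defs.
From HB Require Import structures.
From mathcomp Require Import all_boot all_order all_algebra.
From mathcomp Require Import all_classical all_reals all_analysis.
From mathcomp Require Import ring lra.
Import Order.TTheory GRing.Theory Num.Theory.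
Import numFieldNormedType.Exports.

(** If [f] is [L]-Lipschitz near [x], testing a normal [(u, s)] to the epigraph
    along [x + t u] gives [|u| <= L |s|], and this passes to the limit: the
    singular subdifferential is trivial and the limiting one is bounded.
    Regular subgradients exist near every far point [x], as
    [-2 (L + 1) (p - x)] where [p] minimizes [f + (L + 1) |. - x|^2] on a unit
    ball.

    Conversely, if the singular subdifferential is trivial, normalizing and
    passing to the limit shows that the regular subgradients at far points are
    bounded by some [L]. For [K > L] and [m] a local lower bound of [f],
    minimize [f + K |. - y| + (f y - m) |. - y|^2] on the unit ball around [y]:
    the minimizer is not on the sphere, where the penalty exceeds [f y - m], and
    a minimizer different from [y] would carry a subgradient of norm at least
    [K]. So it is [y], and
    [f y <= f z + K |z - y| + (f y - m) |z - y|^2].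
    Chaining this along a subdivided segment makes [f] [K]-Lipschitz on segments
    avoiding a ball; segments that meet the ball are longer than a fixed
    multiple of the distances of their endpoints to the origin, so there radial
    projection to a sphere, on which [f] is bounded, suffices. *)

Set Implicit Arguments.
Unset Strict Implicit.
Unset Printing Implicit Defensive.

Local Open Scope classical_set_scope.
Local Open Scope ring_scope.

(** * Scalar product and Euclidean norm *)

Lemma edotC (R : realType) n (u v : 'rV[R]_n) : edot u v = edot v u.
Proof. by apply: eq_bigr => i _; rewrite mulrC. Qed.

Lemma edotDl (R : realType) n (u v w : 'rV[R]_n) :
  edot (u + v) w = edot u w + edot v w.
Proof. by rewrite -big_split; apply: eq_bigr => i _; rewrite mxE mulrDl. Qed.

Lemma edotZl (R : realType) n (a : R) (u v : 'rV[R]_n) :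
  edot (a *: u) v = a * edot u v.
Proof. by rewrite mulr_sumr; apply: eq_bigr => i _; rewrite mxE mulrA. Qed.

Lemma edotDr (R : realType) n (u v w : 'rV[R]_n) :
  edot u (v + w) = edot u v + edot u w.
Proof. by rewrite edotC edotDl !(edotC u). Qed.

Lemma edotZr (R : realType) n (a : R) (u v : 'rV[R]_n) :
  edot u (a *: v) = a * edot u v.
Proof. by rewrite edotC edotZl edotC. Qed.

Lemma edotNl (R : realType) n (u v : 'rV[R]_n) : edot (- u) v = - edot u v.
Proof. by rewrite -scaleN1r edotZl mulN1r. Qed.

Lemma edotNr (R : realType) n (u v : 'rV[R]_n) : edot u (- v) = - edot u v.
Proof. by rewrite edotC edotNl edotC. Qed.

Lemma edot_ge0 (R : realType) n (u : 'rV[R]_n) : 0 <= edot u u.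
Proof. by apply: sumr_ge0 => i _; rewrite -expr2 sqr_ge0. Qed.

Lemma enorm_ge0 (R : realType) n (u : 'rV[R]_n) : 0 <= enorm u.
Proof. exact: sqrtr_ge0. Qed.

Lemma sqr_enorm (R : realType) n (u : 'rV[R]_n) : enorm u ^+ 2 = edot u u.
Proof. by rewrite sqr_sqrtr // edot_ge0. Qed.

Lemma enormZ (R : realType) n (a : R) (u : 'rV[R]_n) :
  enorm (a *: u) = `|a| * enorm u.
Proof.
by rewrite /enorm edotZl edotZr mulrA -expr2 sqrtrM ?sqr_ge0// sqrtr_sqr.
Qed.

Lemma enormN (R : realType) n (u : 'rV[R]_n) : enorm (- u) = enorm u.
Proof. by rewrite -scaleN1r enormZ normrN1 mul1r. Qed.

Lemma enormBC (R : realType) n (u v : 'rV[R]_n) : enorm (u - v) = enorm (v - u).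
Proof. by rewrite -enormN opprB. Qed.

Lemma enorm0 (R : realType) n : enorm (0 : 'rV[R]_n) = 0.
Proof. by rewrite -(scale0r 0) enormZ normr0 mul0r. Qed.

Lemma enorm_ge_coord (R : realType) n (u : 'rV[R]_n) i : `|u ord0 i| <= enorm u.
Proof.
rewrite -sqrtr_sqr ler_sqrt ?edot_ge0// /edot (bigD1 i)//= -expr2 lerDl.
by apply: sumr_ge0 => j _; rewrite -expr2 sqr_ge0.
Qed.

Lemma enorm_eq0 (R : realType) n (u : 'rV[R]_n) : (enorm u == 0) = (u == 0).
Proof.
apply/eqP/eqP => [u0|->]; last exact: enorm0.
apply/rowP => i; apply/eqP; rewrite mxE -normr_le0 -u0; exact: enorm_ge_coord.
Qed.

Lemma enorm_gt0 (R : realType) n (u : 'rV[R]_n) : (0 < enorm u) = (u != 0).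
Proof. by rewrite lt0r enorm_eq0 enorm_ge0 andbT. Qed.

(** Cauchy-Schwarz: expand the squared norm of [enorm v *: u - enorm u *: v], which is nonnegative,
    and cancel the positive factor [enorm u * enorm v]. *)
Lemma edot_le (R : realType) n (u v : 'rV[R]_n) :
  edot u v <= enorm u * enorm v.
Proof.
have [->|u0] := eqVneq u 0; first by rewrite enorm0 -(scale0r 0) edotZl !mul0r.
have [->|v0] := eqVneq v 0.
  by rewrite enorm0 -(scale0r 0) edotZr mul0r mulr0.
have uv : 0 < enorm u * enorm v by rewrite mulr_gt0 ?enorm_gt0.
have := edot_ge0 (enorm v *: u - enorm u *: v).
rewrite !(edotDl, edotDr, edotNl, edotNr, edotZl, edotZr) -!sqr_enorm (edotC v).
set a := enorm u in uv *; set b := enorm v in uv *; move=> h.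
rewrite -(ler_pM2l uv); nra.
Qed.

Lemma enormD (R : realType) n (u v : 'rV[R]_n) :
  enorm (u + v) <= enorm u + enorm v.
Proof.
rewrite -(ler_pXn2r (n := 2)) ?nnegrE ?addr_ge0 ?enorm_ge0//.
rewrite sqr_enorm edotDl !edotDr -!sqr_enorm (edotC v).
have := edot_le u v; nra.
Qed.

Lemma enorm_distD (R : realType) n (v u w : 'rV[R]_n) :
  enorm (u - w) <= enorm (u - v) + enorm (v - w).
Proof. by rewrite -[u - w](subrKA v) enormD. Qed.

Lemma enorm_sub (R : realType) n (u v : 'rV[R]_n) :
  enorm u - enorm v <= enorm (u - v).
Proof. by rewrite lerBlDr -{1}(subrK v u) enormD. Qed.

Lemma norm_le_enorm (R : realType) n (u : 'rV[R]_n) : `|u| <= enorm u.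
Proof.
rewrite [leLHS]mx_normrE; apply: bigmax_le; first exact: enorm_ge0.
by move=> [i j] _ /=; rewrite (ord1 i) enorm_ge_coord.
Qed.

Lemma coord_le_norm (R : realType) n (u : 'rV[R]_n) i : `|u ord0 i| <= `|u|.
Proof.
rewrite [leRHS]mx_normrE.
exact: (le_bigmax _ (fun k : 'I_1 * 'I_n => `|u k.1 k.2|) (ord0, i)).
Qed.

(** The crude factor [n], in place of its square root, is enough to compare the two topologies. *)
Lemma enorm_le_norm (R : realType) n (u : 'rV[R]_n) : enorm u <= n%:R * `|u|.
Proof.
rewrite -(ler_pXn2r (n := 2)) ?nnegrE ?mulr_ge0 ?enorm_ge0//.
rewrite sqr_enorm exprMn.
apply: (@le_trans _ _ (\sum_(i < n) `|u| ^+ 2)).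
  apply: ler_sum => i _; rewrite -expr2 -(real_normK (num_real (u ord0 i))).
  by rewrite lerXn2r ?nnegrE// coord_le_norm.
rewrite sumr_const card_ord -[leLHS]mulr_natl.
apply: ler_wpM2r; first exact: sqr_ge0.
by rewrite -natrX ler_nat; case: (n) => // m; rewrite expnS leq_pmulr.
Qed.

(** * Topology in terms of the Euclidean norm; compactness and minima *)

Lemma nbhs_enormP (R : realType) n (x : 'rV[R]_n) (A : set 'rV[R]_n) :
  nbhs x A <-> exists2 d : R, 0 < d & forall y, enorm (y - x) < d -> A y.
Proof.
split=> [/nbhs_ballP[d /= d0 dA]|[d d0 dA]].
  exists d => // y yx; apply: dA; rewrite mx_norm_ball /ball_ /= distrC.
  exact: le_lt_trans (norm_le_enorm _) yx.
(* Dividing by [n.+1] rather than [n] covers dimension 0. *)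
apply/nbhs_ballP; exists (d / n.+1%:R) => /=; first by rewrite divr_gt0.
move=> y; rewrite mx_norm_ball /ball_ /= distrC => yx; apply: dA.
apply: le_lt_trans (enorm_le_norm _) _.
apply: (@le_lt_trans _ _ (n.+1%:R * `|y - x|)).
  by rewrite ler_wpM2r// ler_nat.
by rewrite mulrC -ltr_pdivlMr.
Qed.

Lemma closed_enorm (R : realType) n (A : set 'rV[R]_n) :
  (forall p, (forall d : R, 0 < d -> exists2 z, A z & enorm (z - p) < d) ->
    A p) -> closed A.
Proof.
move=> hA p pA; apply: hA => d d0.
have [|z [Az zp]] := pA [set z | enorm (z - p) < d]; last by exists z.
by apply/nbhs_enormP; exists d.
Qed.

Lemma compact_enorm (R : realType) n (C : R) (A : set 'rV[R]_n) :
  closed A -> (forall x, A x -> enorm x <= C) -> compact A.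
Proof.
move=> clA AC; apply: bounded_closed_compact => //.
exists C; split; first exact: num_real.
move=> M CM x Ax; apply: le_trans (norm_le_enorm x) _.
exact: le_trans (AC _ Ax) (ltW CM).
Qed.

Lemma compact_sphere (R : realType) n (C : R) :
  compact [set x : 'rV[R]_n | enorm x = C].
Proof.
apply: (@compact_enorm _ _ C) => [|x ->//].
apply: closed_enorm => p hp; apply/eqP; rewrite -subr_eq0 -normr_le0.
apply/ler_addgt0Pr => d d0; have [z /= zC zp] := hp d d0.
rewrite add0r -zC ler_norml.
have := enorm_sub z p; have := enorm_sub p z; rewrite (enormBC p); lra.
Qed.

Lemma compact_eball (R : realType) n (y : 'rV[R]_n) (C : R) :
  compact [set x : 'rV[R]_n | enorm (x - y) <= C].
Proof.
apply: (@compact_enorm _ _ (C + enorm y)) => [|x /= xC]; last first.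
  by have := enorm_sub x y; lra.
apply: closed_enorm => p hp /=; apply/ler_addgt0Pr => d d0.
have [z /= zC zp] := hp d d0; have := enorm_distD z p y; rewrite (enormBC p z).
lra.
Qed.

(** The sublevel sets [S b] are nested, hence form a filter base on [A], and any cluster point [p]
    is a minimizer: if [g b < g p], semicontinuity gives [g b < g] on [A] near [p], while [S b]
    meets every neighbourhood of [p]. *)
Lemma lsc_attains_min (T : topologicalType) (R : realType) (A : set T)
    (g : T -> R) : compact A -> A !=set0 ->
  (forall x c, A x -> c < g x -> \forall y \near x, A y -> c < g y) ->
  exists2 p, A p & forall b, A b -> g p <= g b.
Proof.
move=> cA [a Aa] lscg.
pose S b := [set x | A x /\ g x <= g b].
have SF : Filter (filter_from A S).
  apply: filter_from_filter; first by exists a.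
  move=> b c Ab Ac; have [bc|cb] := leP (g b) (g c).
    exists b => // x [Ax xb]; split; split => //; exact: le_trans bc.
  by exists c => // x [Ax xc]; split; split => //; apply: le_trans (ltW cb).
have PF : ProperFilter (filter_from A S).
  by apply: filter_from_proper => b Ab; exists b; split.
have [|p [Ap clp]] := cA (filter_from A S) PF; first by exists a => // x [].
exists p => // b Ab; rewrite leNgt; apply/negP => bp.
have [|x [[Ax xb] /(_ Ax)]] := clp (S b) _ _ (lscg p (g b) Ap bp).
  by exists b.
by rewrite ltNge xb.
Qed.

(** * Pairs in R^n x R and normals to epigraphs *)

Lemma edot_pair (R : realType) n (u v : 'rV[R]_n) (s t : R) :
  edot (rV_pair u s) (rV_pair v t) = edot u v + s * t.
Proof.
rewrite /edot big_split_ord big_ord1 /=; congr (_ + _).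
  by apply: eq_bigr => i _; rewrite !row_mxEl.
by rewrite !row_mxEr !mxE.
Qed.

Lemma rV_pairB (R : realType) n (u v : 'rV[R]_n) (s t : R) :
  rV_pair u s - rV_pair v t = rV_pair (u - v) (s - t).
Proof.
rewrite /rV_pair opp_row_mx add_row_mx; congr row_mx.
by apply/matrixP => i j; rewrite !mxE.
Qed.

Lemma rV_pairZ (R : realType) n (a : R) (u : 'rV[R]_n) (s : R) :
  a *: rV_pair u s = rV_pair (a *: u) (a * s).
Proof.
rewrite /rV_pair scale_row_mx; congr row_mx.
by apply/matrixP => i j; rewrite !mxE.
Qed.

Lemma rV_pairP (R : realType) n (z : 'rV[R]_(n + 1)) :
  exists u s, z = rV_pair u s.
Proof.
exists (lsubmx z), (rsubmx z ord0 ord0); rewrite -[LHS]hsubmxK; congr row_mx.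
by apply/matrixP => i j; rewrite [RHS]mxE (ord1 i) (ord1 j).
Qed.

Lemma lsubmx_pair (R : realType) n (u : 'rV[R]_n) (s : R) :
  lsubmx (rV_pair u s) = u.
Proof. exact: row_mxKl. Qed.

Lemma rsubmx_pair (R : realType) n (u : 'rV[R]_n) (s : R) :
  rsubmx (rV_pair u s) ord0 ord0 = s.
Proof. by rewrite row_mxKr mxE. Qed.

Lemma sqr_enorm_pair (R : realType) n (u : 'rV[R]_n) (s : R) :
  enorm (rV_pair u s) ^+ 2 = enorm u ^+ 2 + s ^+ 2.
Proof. by rewrite !sqr_enorm edot_pair expr2. Qed.

Lemma enorm_pair_le (R : realType) n (u : 'rV[R]_n) (s : R) :
  enorm (rV_pair u s) <= enorm u + `|s|.
Proof.
rewrite -(ler_pXn2r (n := 2)) ?nnegrE ?addr_ge0 ?enorm_ge0//.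
rewrite sqr_enorm_pair -(real_normK (num_real s)).
have := enorm_ge0 u; have := normr_ge0 s; nra.
Qed.

Lemma enorm_pair_fst (R : realType) n (u : 'rV[R]_n) (s : R) :
  enorm u <= enorm (rV_pair u s).
Proof.
rewrite -(ler_pXn2r (n := 2)) ?nnegrE ?enorm_ge0//.
by rewrite sqr_enorm_pair lerDl sqr_ge0.
Qed.

Lemma enorm_pair_snd (R : realType) n (u : 'rV[R]_n) (s : R) :
  `|s| <= enorm (rV_pair u s).
Proof.
rewrite -(ler_pXn2r (n := 2)) ?nnegrE ?enorm_ge0//.
by rewrite sqr_enorm_pair (real_normK (num_real s)) lerDr sqr_ge0.
Qed.

Lemma epi_pairE (R : realType) n (f : 'rV[R]_n -> R) (x : 'rV[R]_n) (r : R) :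
  epi (fun y => (f y)%:E) (rV_pair x r) = (f x <= r).
Proof. by rewrite /epi /= lsubmx_pair rsubmx_pair lee_fin. Qed.

Lemma regular_normal_coneP (R : realType) N (Omega : set 'rV[R]_N)
    (z xi : 'rV[R]_N) :
  regular_normal_cone Omega z xi <-> Omega z /\
  forall e : R, 0 < e -> exists2 d : R, 0 < d &
    forall z', Omega z' -> enorm (z' - z) < d ->
      edot xi (z' - z) <= e * enorm (z' - z).
Proof.
split=> -[Oz h]; split=> // e /h.
  move=> /nbhs_enormP[d d0 hd]; exists d => // z' Oz' zd; exact: hd.
by move=> [d d0 hd]; apply/nbhs_enormP; exists d => // z' zd Oz'; exact: hd.
Qed.

Lemma epi_normalP (R : realType) n (f : 'rV[R]_n -> R) (x u : 'rV[R]_n)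
    (r s : R) :
  regular_normal_cone (epi (fun y => (f y)%:E)) (rV_pair x r) (rV_pair u s)
  <-> f x <= r /\
  forall e : R, 0 < e -> exists2 d : R, 0 < d &
    forall y t, f y <= t -> enorm (rV_pair (y - x) (t - r)) < d ->
      edot u (y - x) + s * (t - r) <= e * enorm (rV_pair (y - x) (t - r)).
Proof.
split=> [/regular_normal_coneP|] [fx h].
  split; first by rewrite epi_pairE in fx.
  move=> e /h[d d0 hd]; exists d => // y t fy yd.
  have := hd (rV_pair y t); rewrite epi_pairE rV_pairB edot_pair; exact.
apply/regular_normal_coneP; split; first by rewrite epi_pairE.
move=> e /h[d d0 hd]; exists d => // z'; have [y [t ->]] := rV_pairP z'.
by rewrite epi_pairE rV_pairB edot_pair; exact: hd.
Qed.

Lemma regular_normal_coneZ (R : realType) N (Omega : set 'rV[R]_N)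
    (z xi : 'rV[R]_N) (a : R) : 0 < a ->
  regular_normal_cone Omega z xi -> regular_normal_cone Omega z (a *: xi).
Proof.
move=> a0 /regular_normal_coneP[Oz h]; apply/regular_normal_coneP.
split=> // e e0.
have [|d d0 hd] := h (e / a); first by rewrite divr_gt0.
exists d => // z' Oz' zd; rewrite edotZl mulrC -ler_pdivlMr// mulrAC.
exact: hd.
Qed.

(** * The normal cone at infinity without sequences, and its closedness *)

Lemma epi_normal_cone_at_infinityP (R : realType) n (F : 'rV[R]_n -> \bar R)
    (zeta : 'rV[R]_(n + 1)) :
  epi_normal_cone_at_infinity F zeta <->
  forall e A : R, 0 < e -> exists x r zeta',
    [/\ A < enorm x, regular_normal_cone (epi F) (rV_pair x r) zeta' &
        enorm (zeta' - zeta) < e].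
Proof.
split=> [[x_ [r_ [zeta_ [epi_ xoo nor_ cvg_]]]] e A e0|h].
  have hx : \forall k \near \oo, A < enorm (x_ k) by move/cvgryPgt : xoo; exact.
  have hz : \forall k \near \oo, enorm (zeta_ k - zeta) < e.
    apply: (cvg_ [set z | enorm (z - zeta) < e]).
    by apply/nbhs_enormP; exists e.
  have [k [xk zk]] := filter_ex (filterI hx hz).
  by exists (x_ k), (r_ k), (zeta_ k).
have /choice[w hw] : forall k : nat, exists w : 'rV[R]_n * R * 'rV[R]_(n + 1),
    [/\ k%:R < enorm w.1.1,
        regular_normal_cone (epi F) (rV_pair w.1.1 w.1.2) w.2 &
        enorm (w.2 - zeta) < k.+1%:R^-1].
  move=> k; have [|x [r [z hz]]] := h k.+1%:R^-1 k%:R; first by rewrite invr_gt0.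
  by exists (x, r, z).
exists (fun k => (w k).1.1), (fun k => (w k).1.2), (fun k => (w k).2); split.
- by move=> k; have [_ []] := hw k.
- apply/cvgryPgt => A; near=> k; have [kx _ _] := hw k.
  apply: lt_trans kx; near: k; exact: nbhs_infty_gtr.
- by move=> k; have [] := hw k.
- move=> V /nbhs_enormP[d d0 dV].
  apply: filterS (near_infty_natSinv_lt (PosNum d0)) => k kd; apply: dV.
  by have [_ _ kz] := hw k; apply: lt_trans kz kd.
Unshelve. all: by end_near. Qed.

Lemma bounded_seq_cluster (R : realType) N (z_ : nat -> 'rV[R]_N) (C : R) :
  (forall k, enorm (z_ k) <= C) ->
  exists z, forall (k0 : nat) (e : R), 0 < e ->
    exists2 k, (k0 <= k)%N & enorm (z_ k - z) < e.
Proof.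
move=> zC; have [|z [_ cz]] := @compact_eball R N 0 C (z_ @ \oo) _.
  by exists 0%N => // k _ /=; rewrite subr0.
exists z => k0 e e0.
have [||_ [[k kk0 <-] kz]] := cz (z_ @` [set k | (k0 <= k)%N])
    [set y | enorm (y - z) < e].
- by exists k0 => // k kk0; exists k.
- by apply/nbhs_enormP; exists e.
- by exists k.
Qed.

(** Bounded normals at points going to infinity have a cluster point. It lies in every [P k], since
    a tail of the sequence does and [P k] is closed. A constant [P] fixes the last coordinate at -1;
    a decreasing [P] forces it to 0. *)
Lemma normal_cone_at_infinity_cluster (R : realType) n (F : 'rV[R]_n -> \bar R)
    (P : nat -> set 'rV[R]_(n + 1)) (C : R) :
  (forall k, closed (P k)) -> (forall k l, (k <= l)%N -> P l `<=` P k) ->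
  (forall k, exists x r zeta, [/\ k%:R < enorm x,
      regular_normal_cone (epi F) (rV_pair x r) zeta, P k zeta &
      enorm zeta <= C]) ->
  exists2 zeta, epi_normal_cone_at_infinity F zeta & forall k, P k zeta.
Proof.
move=> clP decP h.
have /choice[w hw] : forall k : nat, exists w : 'rV[R]_n * R * 'rV[R]_(n + 1),
    [/\ k%:R < enorm w.1.1,
        regular_normal_cone (epi F) (rV_pair w.1.1 w.1.2) w.2, P k w.2 &
        enorm w.2 <= C].
  by move=> k; have [x [r [z hz]]] := h k; exists (x, r, z).
have [|z hz] := @bounded_seq_cluster _ _ (fun k => (w k).2) C.
  by move=> k; have [] := hw k.
exists z; last first.
  move=> k; apply: (clP k) => V /nbhs_enormP[d d0 dV].
  have [l kl lz] := hz k _ d0; exists (w l).2; split; last exact: dV.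
  by apply: (decP _ _ kl); have [] := hw l.
apply/epi_normal_cone_at_infinityP => e A e0.
have [k Ak kz] := hz (Num.bound `|A|) _ e0.
exists (w k).1.1, (w k).1.2, (w k).2; have [kx ? _ _] := hw k; split => //.
apply: lt_trans kx; apply: (@lt_le_trans _ _ (Num.bound `|A|)%:R).
  exact: le_lt_trans (ler_norm A) (archi_boundP (normr_ge0 A)).
by rewrite ler_nat.
Qed.

Lemma closed_normal_cone_at_infinity (R : realType) n (F : 'rV[R]_n -> \bar R) :
  closed (epi_normal_cone_at_infinity F).
Proof.
apply: closed_enorm => p hp; apply/epi_normal_cone_at_infinityP => e A e0.
have e20 : 0 < e / 2 by rewrite divr_gt0.
have [z /epi_normal_cone_at_infinityP hz zp] := hp _ e20.
have [x [r [zeta [Ax nor zz]]]] := hz _ A e20.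
exists x, r, zeta; split => //; have := enorm_distD z zeta p; lra.
Qed.

(** * Normals from quadratic minorants, and normals of Lipschitz functions *)

Lemma proximal_normal (R : realType) n (f : 'rV[R]_n -> R) (x u : 'rV[R]_n)
    (c d : R) : 0 <= c -> 0 < d ->
  (forall y, enorm (y - x) < d ->
     f x + edot u (y - x) - c * enorm (y - x) ^+ 2 <= f y) ->
  regular_normal_cone (epi (fun y => (f y)%:E)) (rV_pair x (f x))
    (rV_pair u (-1)).
Proof.
move=> c0 d0 h; apply/epi_normalP; split=> // e e0.
have c1 : 0 < c + 1 by lra.
(* Within this radius [c * enorm (y - x) <= e], which absorbs the quadratic term; [c + 1] keeps the
   denominator positive. *)
exists (Num.min d (e / (c + 1))); first by rewrite lt_min d0 divr_gt0.
move=> y t fy; rewrite lt_min ltr_pdivlMr// => /andP[yd ye].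
have yp := enorm_pair_fst (y - x) (t - f x).
have := h y (le_lt_trans yp yd).
move: yp ye; set a := enorm (y - x); set b := enorm (rV_pair _ _).
have a0 : 0 <= a by exact: enorm_ge0.
move=> ab be; suff : c * a ^+ 2 <= e * b by lra.
have : c * a <= e by nra.
move=> cae; rewrite expr2 mulrA; apply: ler_pM => //; exact: mulr_ge0.
Qed.

Lemma lipschitz_normal_le (R : realType) n (f : 'rV[R]_n -> R)
    (x u : 'rV[R]_n) (r s L d : R) : 0 <= L -> 0 < d ->
  (forall y, enorm (y - x) < d -> `|f y - f x| <= L * enorm (y - x)) ->
  regular_normal_cone (epi (fun y => (f y)%:E)) (rV_pair x r) (rV_pair u s) ->
  enorm u <= L * `|s|.
Proof.
move=> L0 d0 fL /epi_normalP[fxr h].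
have [->|u0] := eqVneq u 0; first by rewrite enorm0 mulr_ge0.
have un0 : 0 < enorm u by rewrite enorm_gt0.
have L1 : 0 < 1 + L by lra.
apply/ler_addgt0Pr => e e0.
have [|d' d'0 hd'] := h (e / (1 + L)); first by rewrite divr_gt0.
(* [tau] is the length of the displacement along [u]. The induced displacement in the graph has
   length at most [tau * (1 + L)], which explains both this bound and the tolerance [e / (1 + L)]
   above. *)
pose tau := Num.min d (d' / (1 + L)) / 2.
have tau0 : 0 < tau by rewrite divr_gt0// lt_min d0 divr_gt0.
have tau_d : tau < d.
  by rewrite /tau ltr_pdivrMr// gt_min; apply/orP; left; lra.
have tau_d' : tau * (1 + L) < d'.
  rewrite -ltr_pdivlMr// /tau ltr_pdivrMr// gt_min; apply/orP; right.
  have : 0 < d' / (1 + L) by rewrite divr_gt0.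
  lra.
pose t := tau / enorm u.
have tu : t * enorm u = tau by rewrite /t divfK// gt_eqF.
have t0 : 0 < t by rewrite divr_gt0.
pose y := x + t *: u.
have yx : y - x = t *: u by rewrite /y addrC addKr.
have eyx : enorm (y - x) = tau by rewrite yx enormZ gtr0_norm.
have Delta := fL y; rewrite eyx in Delta; have {}Delta := Delta tau_d.
(* The base point may lie strictly above the graph; shifting its height by [f y - f x] keeps it in
   the epigraph. *)
have := hd' y (r + (f y - f x)).
have -> : r + (f y - f x) - r = f y - f x by lra.
have pair_le : enorm (rV_pair (y - x) (f y - f x)) <= tau * (1 + L).
  by apply: le_trans (enorm_pair_le _ _) _; rewrite eyx; lra.
move=> /(_ ltac:(lra) (le_lt_trans pair_le tau_d')).
rewrite {1}yx edotZr -sqr_enorm expr2 mulrA tu => hle.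
have : e / (1 + L) * enorm (rV_pair (y - x) (f y - f x)) <= e * tau.
  rewrite mulrAC ler_pdivrMr// -mulrA ler_wpM2l//; exact: ltW.
have : - (`|s| * (L * tau)) <= s * (f y - f x).
  rewrite lerNl -mulrN; apply: le_trans (ler_norm _) _.
  by rewrite normrM normrN ler_wpM2l.
move=> h1 h2; rewrite -(ler_pM2l tau0); nra.
Qed.

(** * Minimizers of penalized functions *)

Lemma lsc_penalized_min (R : realType) n (f : 'rV[R]_n -> R) (y : 'rV[R]_n)
    (K M r : R) : lower_semicontinuous (fun x => (f x)%:E) ->
  0 <= K -> 0 <= M -> 0 <= r ->
  exists2 p, enorm (p - y) <= r &
    forall z, enorm (z - y) <= r ->
      f p + K * enorm (p - y) + M * enorm (p - y) ^+ 2 <=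
      f z + K * enorm (z - y) + M * enorm (z - y) ^+ 2.
Proof.
move=> lscf K0 M0 r0.
apply: (@lsc_attains_min _ _ [set z | enorm (z - y) <= r]
  (fun z => f z + K * enorm (z - y) + M * enorm (z - y) ^+ 2)).
- exact: compact_eball.
- by exists y; rewrite /= subrr enorm0.
move=> x c _ cx; set a := enorm (x - y) in cx.
have a0 : 0 <= a by exact: enorm_ge0.
(* Half of the gap is spent on the drop of [f], half on the drop of the penalty. *)
pose eta := (f x + K * a + M * a ^+ 2 - c) / 2.
have eta0 : 0 < eta by rewrite divr_gt0// subr_gt0.
have [|V /nbhs_enormP[d d0 dV] hV] := lscf x (f x - eta).
  by rewrite lte_fin; lra.
have S0 : 0 < K + 2 * M * a + 1 by nra.
apply/nbhs_enormP; exists (Num.min d (eta / (K + 2 * M * a + 1))).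
  by rewrite lt_min d0 divr_gt0.
move=> z; rewrite lt_min ltr_pdivlMr// => /andP[/dV/hV].
rewrite lte_fin => fz zx _.
have := enorm_distD z x y; rewrite -/a (enormBC x z) => azb.
move: azb zx; set b := enorm (z - y); set del := enorm (z - x) => azb zx.
have del0 : 0 <= del by exact: enorm_ge0.
(* convexity of [t |-> K t + M t^2] *)
have cvx : K * a + M * a ^+ 2 - del * (K + 2 * M * a) <= K * b + M * b ^+ 2.
  have : 0 <= (b - a + del) * (K + 2 * M * a) by apply: mulr_ge0; nra.
  have : 0 <= M * (b - a) ^+ 2 by apply: mulr_ge0 => //; exact: sqr_ge0.
  by move=> h1 h2; nra.
by move: zx; rewrite /eta in fz *; nra.
Qed.

(** The slope of the conical penalty is written [k * enorm (p - y)], so that no division occurs and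
    [k = 0] leaves the purely quadratic penalty. Both penalties are bounded above by quadratics
    touching them at [p], so minimality gives [f] a quadratic minorant at [p]. *)
Lemma penalized_min_normal (R : realType) n (f : 'rV[R]_n -> R)
    (y p : 'rV[R]_n) (k M r : R) : 0 <= k -> 0 <= M -> enorm (p - y) < r ->
  (forall z, enorm (z - y) <= r ->
     f p + k * enorm (p - y) * enorm (p - y) + M * enorm (p - y) ^+ 2 <=
     f z + k * enorm (p - y) * enorm (z - y) + M * enorm (z - y) ^+ 2) ->
  regular_normal_cone (epi (fun x => (f x)%:E)) (rV_pair p (f p))
    (rV_pair (- (k + 2 * M) *: (p - y)) (-1)).
Proof.
move=> k0 M0 pr hp.
apply: (@proximal_normal _ _ _ _ _ (k / 2 + M) (r - enorm (p - y))).
- by apply: addr_ge0 => //; apply: divr_ge0.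
- by rewrite subr_gt0.
move=> z zp; have := hp z; have := enorm_distD p z y.
have zy : z - y = (p - y) + (z - p) by rewrite [RHS]addrC subrKA.
have : enorm (z - y) ^+ 2 =
    enorm (p - y) ^+ 2 + 2 * edot (p - y) (z - p) + enorm (z - p) ^+ 2.
  rewrite !sqr_enorm zy; move: (p - y) (z - p) => v w.
  by rewrite edotDl !edotDr (edotC w v); ring.
rewrite edotZl; set a := enorm (p - y) in pr zp *; set b := enorm (z - y).
set c := enorm (z - p) in zp *; set q := edot _ _ => bE bac.
move=> /(_ ltac:(lra)).
(* By [2 * a * b <= a ^+ 2 + b ^+ 2] and the expansion of [b ^+ 2]. *)
have : k * (a * b - a ^+ 2) <= k * (q + c ^+ 2 / 2).
  by apply: ler_wpM2l => //; have := sqr_ge0 (a - b); nra.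
rewrite bE; lra.
Qed.

(** * From bounded subgradients to Lipschitz estimates *)

Lemma bounded_normal_step (R : realType) n (f : 'rV[R]_n -> R) (y : 'rV[R]_n)
    (L K m : R) : lower_semicontinuous (fun x => (f x)%:E) ->
  0 <= L -> L < K ->
  (forall x u : 'rV[R]_n, enorm (x - y) < 1 ->
     regular_normal_cone (epi (fun x => (f x)%:E)) (rV_pair x (f x))
       (rV_pair u (-1)) -> enorm u <= L) ->
  (forall z, enorm (z - y) <= 1 -> m <= f z) ->
  forall z, enorm (z - y) <= 1 ->
    f y <= f z + K * enorm (z - y) + (f y - m) * enorm (z - y) ^+ 2.
Proof.
move=> lscf L0 LK normL mf; have K0 : 0 < K by lra.
have M0 : 0 <= f y - m by rewrite subr_ge0 mf// subrr enorm0.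
have [p p1 hp] := lsc_penalized_min y lscf (ltW K0) M0 ler01.
suff py : p = y by move: hp; rewrite py subrr enorm0 mulr0 expr0n/= mulr0 !addr0.
apply/eqP; rewrite -subr_eq0; apply/negPn/negP => py0.
have w0 : 0 < enorm (p - y) by rewrite enorm_gt0.
(* On the sphere, comparing with [y] would give [f p <= m - K < m]. *)
move: p1; rewrite le_eqVlt => /predU1P[p1|p1].
  have := hp y; rewrite subrr enorm0 ler01 p1 => /(_ isT).
  have := mf p; rewrite p1 lexx => /(_ isT); lra.
have kE : K / enorm (p - y) * enorm (p - y) = K by rewrite divfK// gt_eqF.
have k0 : 0 <= K / enorm (p - y) by rewrite divr_ge0 ?enorm_ge0// ltW.
have := @penalized_min_normal _ _ f y p _ _ 1 k0 M0 p1; rewrite kE.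
move=> /(_ hp)/(normL _ _ p1); rewrite enormZ normrN ger0_norm; last by lra.
(* The subgradient has norm [K + 2 * (f y - m) * enorm (p - y)], which exceeds [L]. *)
by rewrite mulrDl kE; nra.
Qed.

(** Each of [N] steps of length [h = D / N] costs [K * h] plus an error of order [h ^+ 2]; the
    errors add up to order [D ^+ 2 / N], which is arbitrarily small. *)
Lemma bounded_normal_segment (R : realType) n (f : 'rV[R]_n -> R)
    (x x' : 'rV[R]_n) (L K : R) : lower_semicontinuous (fun x => (f x)%:E) ->
  0 <= L -> L < K ->
  (forall (t : R) (z u : 'rV[R]_n), 0 <= t <= 1 ->
     enorm (z - (x + t *: (x' - x))) < 1 ->
     regular_normal_cone (epi (fun x => (f x)%:E)) (rV_pair z (f z))
       (rV_pair u (-1)) -> enorm u <= L) ->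
  f x' <= f x + K * enorm (x' - x).
Proof.
move=> lscf L0 LK normL; set D := enorm (x' - x).
have D0 : 0 <= D by exact: enorm_ge0.
(* With zero penalty this just minimizes [f]; the ball of radius [D + 1] contains the unit balls
   around all points of the segment. *)
have [|q _ hq] := lsc_penalized_min x lscf (lexx 0) (lexx 0) (r := D + 1).
  by lra.
pose m := f q.
have mf z : enorm (z - x) <= D + 1 -> m <= f z.
  by move=> /hq; rewrite !mul0r !addr0.
apply/ler_addgt0Pr => e e0.
have Fx'0 : 0 <= f x' - m by rewrite subr_ge0 mf// -/D; lra.
(* For [N > B] the summands give, in order, [h <= 1], [N * h ^+ 2 <= 1] and a final error of at most
   [e]. *)
pose B := D + D ^+ 2 + (f x' - m) * D ^+ 2 / e + 1.
have fe0 : 0 <= (f x' - m) * D ^+ 2 / e.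
  by rewrite !mulr_ge0// ?sqr_ge0// invr_ge0 ltW.
have B0 : 0 < B by rewrite /B; have := sqr_ge0 D; lra.
pose N := Num.bound B.
have NB : B < N%:R := archi_boundP (ltW B0).
have N0 : 0 < N%:R :> R by lra.
pose h := D / N%:R.
have hN : h * N%:R = D by rewrite /h divfK// gt_eqF.
have h0 : 0 <= h by rewrite divr_ge0.
have h1 : h <= 1.
  by rewrite /h ler_pdivrMr// mul1r; move: NB; rewrite /B; have := sqr_ge0 D; lra.
have Nh2E : N%:R * h ^+ 2 = D ^+ 2 / N%:R.
  by rewrite /h expr2; field; rewrite gt_eqF.
have Nh2 : N%:R * h ^+ 2 <= 1.
  by rewrite Nh2E ler_pdivrMr// mul1r; move: NB; rewrite /B; lra.
pose p (i : nat) := x + (i%:R / N%:R) *: (x' - x).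
have pS i : p i.+1 - p i = N%:R^-1 *: (x' - x).
  by rewrite /p opprD addrACA subrr add0r -scalerBl -mulrBl -natrB// subSnn mul1r.
have pdist i : enorm (p i.+1 - p i) = h.
  by rewrite pS enormZ ger0_norm ?invr_ge0 ?(ltW N0)// mulrC.
have t01 i : (i <= N)%N -> 0 <= (i%:R / N%:R : R) <= 1.
  by move=> iN; rewrite divr_ge0//= ler_pdivrMr// mul1r ler_nat.
have px i : (i <= N)%N -> enorm (p i - x) <= D.
  move=> iN; have /andP[t0 t1] := t01 i iN.
  by rewrite /p addrC addKr enormZ ger0_norm// ler_piMl.
have mp i : (i <= N)%N -> m <= f (p i) by move=> /px pD; apply: mf; lra.
(* a discrete Gronwall inequality; the factor tends to 1 as N grows *)
have key i : (i <= N)%N ->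
    (f (p i) - m) * (1 - i%:R * h ^+ 2) <= f x - m + K * h * i%:R.
  elim: i => [_|i IH iN].
    by rewrite /p mul0r scale0r !addr0 mul0r subr0 mulr1 mulr0 addr0.
  have {}IH := IH (ltnW iN).
  (* The one-step bound is centred at the new point, so its error involves [f (p i.+1)] and has to
     be moved to the left-hand side. *)
  have step : f (p i.+1) <= f (p i) + K * h + (f (p i.+1) - m) * h ^+ 2.
    rewrite -(pdist i) (enormBC (p i.+1)).
    apply: (@bounded_normal_step _ _ f _ L) => //; last by rewrite enormBC pdist.
      by move=> z u; exact/normL/t01.
    move=> z zp; apply: mf.
    by have := enorm_distD (p i.+1) z x; have := px _ iN; lra.
  have ih2 : i%:R * h ^+ 2 <= 1.
    apply: le_trans Nh2; rewrite ler_wpM2r ?sqr_ge0// ler_nat; exact: ltnW.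
  have i0 : 0 <= i%:R :> R by [].
  have F0 : 0 <= f (p i.+1) - m by rewrite subr_ge0 mp.
  have Kh : 0 <= K * h by rewrite mulr_ge0//; lra.
  move: IH F0 ih2 step; rewrite -natr1.
  have := sqr_ge0 h; set h2 := h ^+ 2; set F := f (p i.+1) - m.
  move=> h20 IH F0 ih2 step.
  have st : F * (1 - h2) <= f (p i) - m + K * h by rewrite /F in step *; lra.
  have : F * (1 - h2) * (1 - i%:R * h2) <=
      (f (p i) - m + K * h) * (1 - i%:R * h2) by rewrite ler_wpM2r// subr_ge0.
  have ih20 : 0 <= i%:R * h2 by exact: mulr_ge0.
  (* This is [F] times the excess of [(1 - h2) * (1 - i * h2)] over [1 - (i + 1) * h2]. *)
  have : 0 <= F * (h2 * (i%:R * h2)) by do 2!apply: mulr_ge0 => //.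
  have : 0 <= K * h * (i%:R * h2) by exact: mulr_ge0.
  lra.
have pN : p N = x' by rewrite /p divff ?gt_eqF// scale1r addrC subrK.
have := key N (leqnn N); rewrite pN -mulrA hN.
have : (f x' - m) * (N%:R * h ^+ 2) <= e.
  rewrite Nh2E mulrA ler_pdivrMr// (mulrC e) -ler_pdivrMr//.
  move: NB; rewrite /B.
  have := sqr_ge0 D; lra.
lra.
Qed.

(** * From segments avoiding a ball to all pairs of far points *)

Lemma segment_lipschitz_at_infinity (R : realType) n (f : 'rV[R]_n -> R)
    (K rad : R) : lower_semicontinuous (fun x => (f x)%:E) ->
  0 <= K -> 0 < rad ->
  (forall x x' : 'rV[R]_n,
     (forall t : R, 0 <= t <= 1 -> rad <= enorm (x + t *: (x' - x))) ->
     f x' <= f x + K * enorm (x' - x)) ->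
  lipschitz_at_infinity f.
Proof.
move=> lscf K0 rad0 seg.
(* [B] is the oscillation of [f] on the sphere of radius [2 * rad]: the lower bound comes from
   semicontinuity, the upper one from [seg], which makes [- f] lower semicontinuous there. In
   dimension 0 the sphere is empty. *)
have [B hB] : exists B, forall x x' : 'rV[R]_n,
    enorm x = 2 * rad -> enorm x' = 2 * rad -> f x' <= f x + B.
  have [[a aS]|S0] := pselect ([set x : 'rV[R]_n | enorm x = 2 * rad] !=set0);
    last by exists 0 => x x' xS; exfalso; apply: S0; exists x.
  have [|q _ hq] := lsc_penalized_min (0 : 'rV[R]_n) lscf (lexx 0) (lexx 0)
    (r := 2 * rad); first by lra.
  have [||p _ hp] := @lsc_attains_min _ _ [set x : 'rV[R]_n | enorm x = 2 * rad]
      (fun x => - f x) (@compact_sphere _ _ _); first by exists a.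
    move=> x c /= xS cx; apply/nbhs_enormP.
    (* A segment of length below [rad] starting on the sphere of radius [2 * rad] stays outside the
       ball of radius [rad]. *)
    exists (Num.min rad ((- f x - c) / (K + 1))).
      by rewrite lt_min rad0 divr_gt0 ?subr_gt0//; lra.
    move=> y; rewrite lt_min => /andP[yr].
    rewrite ltr_pdivlMr; last by lra.
    move=> yK _; have := enorm_ge0 (y - x).
    suff : f y <= f x + K * enorm (y - x) by lra.
    apply: seg => t /andP[t0 t1].
    have := enorm_sub x (- (t *: (y - x))).
    rewrite opprK enormN enormZ ger0_norm// xS; have := enorm_ge0 (y - x); nra.
  exists (f p - f q) => x x' xS x'S.
  have := hp x' x'S; have := hq x; rewrite subr0 xS lexx !mul0r !addr0.
  by move=> /(_ isT); lra.
have radial (x : 'rV[R]_n) : 2 * rad < enorm x -> exists x0 : 'rV[R]_n,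
    [/\ enorm x0 = 2 * rad, f x0 <= f x + K * enorm x &
        f x <= f x0 + K * enorm x].
  move=> xr; have x0 : 0 < enorm x by lra.
  pose c := 2 * rad / enorm x.
  have cx : c * enorm x = 2 * rad by rewrite /c divfK// gt_eqF.
  have c0 : 0 < c by rewrite /c divr_gt0//; lra.
  have c1 : c < 1 by rewrite /c ltr_pdivrMr// mul1r.
  have dist : enorm (x - c *: x) <= enorm x.
    rewrite -{1}(scale1r x) -scalerBl enormZ ger0_norm; nra.
  exists (c *: x); split; first by rewrite enormZ gtr0_norm.
  - apply: (@le_trans _ _ (f x + K * enorm (c *: x - x))).
      apply: seg => t /andP[t0 t1].
      have -> : x + t *: (c *: x - x) = (1 + t * (c - 1)) *: x.
        by rewrite scalerDl -scalerA scalerBl scale1r.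
      rewrite enormZ ger0_norm; nra.
    by rewrite lerD2l enormBC ler_wpM2l.
  - apply: (@le_trans _ _ (f (c *: x) + K * enorm (x - c *: x))).
      apply: seg => t /andP[t0 t1].
      have -> : c *: x + t *: (x - c *: x) = (c + t * (1 - c)) *: x.
        by rewrite scalerDl -scalerA scalerBl scale1r.
      have cc : c <= c + t * (1 - c) by nra.
      rewrite enormZ ger0_norm; nra.
    by rewrite lerD2l ler_wpM2l.
(* When the segment meets the ball, its length is at least [(enorm x + enorm x') / 2] and at least
   [2 * rad]. So [2 * K] pays for the two radial moves and the second term for the move on the
   sphere; the last one makes [L] positive. *)
pose L := 2 * K + `|B| / (2 * rad) + 1.
have Br : 0 <= `|B| / (2 * rad) by apply: divr_ge0 => //; lra.
have onesided (x x' : 'rV[R]_n) : 2 * rad < enorm x -> 2 * rad < enorm x' ->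
    f x' <= f x + L * enorm (x' - x).
  move=> xr x'r; have D0 := enorm_ge0 (x' - x).
  have [away|] := pselect (forall t : R, 0 <= t <= 1 ->
      rad <= enorm (x + t *: (x' - x))).
    have := seg _ _ away; rewrite /L; nra.
  move=> /existsNP[t /not_implyP[/andP[t0 t1] /negP]]; rewrite -ltNge => pr.
  (* Add the triangle inequalities from each endpoint to the point of the segment inside the
     ball. *)
  have far : enorm x + enorm x' - 2 * rad <= enorm (x' - x).
    have := enorm_sub x (x + t *: (x' - x)).
    have := enorm_sub x' (x + t *: (x' - x)).
    have -> : x - (x + t *: (x' - x)) = - (t *: (x' - x)).
      by rewrite opprD addrA subrr add0r.
    rewrite enormN enormZ ger0_norm//.
    have -> : x' - (x + t *: (x' - x)) = (1 - t) *: (x' - x).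
      by rewrite scalerBl scale1r opprD addrA.
    by rewrite enormZ ger0_norm; lra.
  have [x0 [x0r fx0 _]] := radial x xr.
  have [x0' [x0'r _ fx0']] := radial x' x'r.
  have := hB _ _ x0r x0'r; have := ler_norm B.
  have : `|B| <= `|B| / (2 * rad) * enorm (x' - x).
    by rewrite mulrAC ler_pdivlMr ?ler_wpM2l//; lra.
  rewrite /L; nra.
exists L, (2 * rad); split; rewrite ?/L; [lra..|].
move=> x x' xr x'r; rewrite ler_norml.
have := onesided x x' xr x'r; have := onesided x' x x'r xr.
by rewrite (enormBC x' x) /L; lra.
Qed.

Lemma bounded_normal_lipschitz (R : realType) n (f : 'rV[R]_n -> R)
    (L rad : R) : lower_semicontinuous (fun x => (f x)%:E) ->
  0 <= L -> 0 <= rad ->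
  (forall x u : 'rV[R]_n, rad < enorm x ->
     regular_normal_cone (epi (fun x => (f x)%:E)) (rV_pair x (f x))
       (rV_pair u (-1)) -> enorm u <= L) ->
  lipschitz_at_infinity f.
Proof.
move=> lscf L0 rad0 normL.
(* The radius grows by 1 so that unit balls around points of the segment stay where the subgradients
   are bounded. *)
apply: (@segment_lipschitz_at_infinity _ _ f (L + 1) (rad + 1)) => //; [lra..|].
move=> x x' away; apply: (@bounded_normal_segment _ _ f x x' L) => //.
  by lra.
move=> t z u t01 zd; apply: normL; have := away t t01.
by have := enorm_sub (x + t *: (x' - x)) z; rewrite enormBC; lra.
Qed.

(** * Subdifferentials at infinity of functions Lipschitz at infinity *)

Lemma enorm_unbounded (R : realType) n (A : R) : (0 < n)%N ->
  exists x : 'rV[R]_n, A < enorm x.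
Proof.
case: n => // n _; exists (const_mx (`|A| + 1)).
apply: lt_le_trans (enorm_ge_coord _ ord0); rewrite mxE.
have := ler_norm A; have := ler_norm (`|A| + 1); lra.
Qed.

(** The bound for normals at far points survives the limit: an approximation within [e / (L + 1)]
    costs at most [e]. Taking [s = 0] gives [u = 0], and [s = -1] gives [enorm u <= L]. *)
Lemma lipschitz_normal_at_infinity (R : realType) n (f : 'rV[R]_n -> R)
    (L rad : R) (u : 'rV[R]_n) (s : R) : 0 <= L ->
  (forall x x' : 'rV[R]_n, rad < enorm x -> rad < enorm x' ->
      `|f x - f x'| <= L * enorm (x - x')) ->
  epi_normal_cone_at_infinity (fun x => (f x)%:E) (rV_pair u s) ->
  enorm u <= L * `|s|.
Proof.
move=> L0 fL /epi_normal_cone_at_infinityP h.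
apply/ler_addgt0Pr => e e0; have L1 : 0 < L + 1 by lra.
have [|x [r [zeta [xr nor]]]] := h (e / (L + 1)) rad; first by rewrite divr_gt0.
have [v [t zE]] := rV_pairP zeta; rewrite zE in nor *.
rewrite rV_pairB ltr_pdivlMr// => ze.
have := enorm_pair_fst (v - u) (t - s); have := enorm_pair_snd (v - u) (t - s).
have : enorm v <= L * `|t|.
  apply: (@lipschitz_normal_le _ _ f x v r t L (enorm x - rad)) => //.
    by rewrite subr_gt0.
  move=> y yx; apply: fL => //.
  by have := enorm_sub x y; rewrite enormBC; lra.
have := enorm_sub u v; rewrite enormBC; have := lerB_dist t s.
nra.
Qed.

Lemma lipschitz_subdiff_at_infinity_nonempty (R : realType) n
    (f : 'rV[R]_n -> R) : (0 < n)%N ->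
  lower_semicontinuous (fun x => (f x)%:E) -> lipschitz_at_infinity f ->
  subdiff_at_infinity (fun x => (f x)%:E) !=set0.
Proof.
move=> n0 lscf [L [rad [L0 rad0 fL]]].
pose P (k : nat) := [set z : 'rV[R]_(n + 1) | rsubmx z ord0 ord0 = -1].
have L1 : 0 <= L + 1 by lra.
have [|||z hz /(_ 0%N)] := @normal_cone_at_infinity_cluster _ _
    (fun x => (f x)%:E) P (2 * (L + 1) + 1).
- move=> k; apply: closed_enorm => p hp; apply/eqP.
  rewrite -subr_eq0 -normr_le0; apply/ler_addgt0Pr => d d0.
  have [z /=] := hp d d0; have [u [s ->]] := rV_pairP z.
  have [v [t ->]] := rV_pairP p; rewrite /P /= !rsubmx_pair => ->.
  rewrite rV_pairB => pd; have := enorm_pair_snd (u - v) (-1 - t).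
  by rewrite distrC; lra.
- by move=> k l _ z.
(* The extra 1 keeps the minimizer on the unit ball around [x] in the far region. *)
- move=> k; have [x xk] := @enorm_unbounded R n (k%:R + rad + 1) n0.
  have [p px hp] := lsc_penalized_min x lscf (lexx 0) L1 ler01.
  have k0 : 0 <= k%:R :> R by [].
  have pk : k%:R + rad < enorm p.
    by have := enorm_sub x p; rewrite enormBC; lra.
  have p1 : enorm (p - x) < 1.
    have := hp x; rewrite subrr enorm0 ler01 => /(_ isT).
    have := fL x p; rewrite (enormBC x p) => /(_ ltac:(lra) ltac:(lra)).
    (* If [enorm (p - x)] were at least 1, minimality would give [(L + 1) * enorm (p - x) <= f x - f
       p <= L * enorm (p - x)]. *)
    rewrite ler_norml ltNge => /andP[_ fxp] hpx; apply/negP => a1.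
    have : (L + 1) * enorm (p - x) <= (L + 1) * enorm (p - x) ^+ 2.
      by apply: ler_wpM2l => //; nra.
    rewrite expr0n /= in hpx; lra.
  exists p, (f p), (rV_pair (- (0 + 2 * (L + 1)) *: (p - x)) (-1)); split.
  + by lra.
  + apply: (@penalized_min_normal _ _ _ _ _ _ _ 1) => // y /hp.
    by rewrite !mul0r.
  + by rewrite /P /= rsubmx_pair.
  + apply: le_trans (enorm_pair_le _ _) _.
    rewrite enormZ normrN normrN1 add0r ger0_norm; last by lra.
    nra.
- have [u [s zE]] := rV_pairP z; rewrite zE /P /= rsubmx_pair => s1.
  by exists u; rewrite /subdiff_at_infinity /= -s1 -zE.
Qed.

Lemma lipschitz_subdiff_at_infinity_compact (R : realType) n
    (f : 'rV[R]_n -> R) : lipschitz_at_infinity f ->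
  compact (subdiff_at_infinity (fun x => (f x)%:E)).
Proof.
move=> [L [rad [L0 _ fL]]]; apply: (@compact_enorm _ _ L); last first.
  move=> u /(lipschitz_normal_at_infinity (ltW L0) fL).
  by rewrite normrN1 mulr1.
apply: closed_enorm => p hp; apply: closed_normal_cone_at_infinity.
move=> V /nbhs_enormP[d d0 dV]; have [z hz zp] := hp d d0.
exists (rV_pair z (-1)); split => //; apply: dV; rewrite rV_pairB subrr.
by apply: le_lt_trans (enorm_pair_le _ _) _; rewrite normr0 addr0.
Qed.

(** * The singular subdifferential at infinity and the equivalence *)

Lemma singular_subdiff_at_infinity0 (R : realType) n (F : 'rV[R]_n -> R) :
  (0 < n)%N -> singular_subdiff_at_infinity (fun x => (F x)%:E) 0.
Proof.
move=> n0; apply/epi_normal_cone_at_infinityP => e A e0.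
have [x Ax] := @enorm_unbounded R n A n0.
exists x, (F x), (rV_pair 0 0); split => //; last by rewrite subrr enorm0.
apply/epi_normalP; split=> // d d0; exists 1 => // y t _ _.
by rewrite -{1}(scale0r 0) edotZl !mul0r addr0 mulr_ge0 ?enorm_ge0// ltW.
Qed.

Lemma singular_subdiff0_lipschitz (R : realType) n (f : 'rV[R]_n -> R) :
  lower_semicontinuous (fun x => (f x)%:E) ->
  singular_subdiff_at_infinity (fun x => (f x)%:E) `<=` [set 0] ->
  lipschitz_at_infinity f.
Proof.
move=> lscf sing0.
suff [k hk] : exists k : nat, forall x u : 'rV[R]_n, k%:R < enorm x ->
    regular_normal_cone (epi (fun x => (f x)%:E)) (rV_pair x (f x))
      (rV_pair u (-1)) -> enorm u <= k%:R.
  exact: (@bounded_normal_lipschitz _ _ f k%:R k%:R).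
apply: contrapT => /forallNP unb.
(* [(u, -1)] divided by [enorm u], for a subgradient [u] of norm above [k.+1], lies in [P k]. A
   point in all [P k] has the form [(u, 0)] with [u] a unit vector, contradicting [sing0]. *)
pose P (k : nat) := [set z : 'rV[R]_(n + 1) |
  enorm (lsubmx z) = 1 /\ `|rsubmx z ord0 ord0| <= k.+1%:R^-1].
have [|||z hz Pz] := @normal_cone_at_infinity_cluster _ _
    (fun x => (f x)%:E) P 2.
- move=> k; apply: closed_enorm => p hp.
  have [v [t pE]] := rV_pairP p; rewrite pE /P /= lsubmx_pair rsubmx_pair.
  split.
    apply/eqP; rewrite -subr_eq0 -normr_le0; apply/ler_addgt0Pr => d d0.
    have [z] := hp d d0; have [u [s ->]] := rV_pairP z.
    rewrite pE rV_pairB /P /= lsubmx_pair => -[u1 _] ud.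
    have := enorm_pair_fst (u - v) (s - t); have := enorm_sub u v.
    have := enorm_sub v u; rewrite (enormBC v) u1 add0r ler_norml; lra.
  apply/ler_addgt0Pr => d d0.
  have [z] := hp d d0; have [u [s ->]] := rV_pairP z.
  rewrite pE rV_pairB /P /= rsubmx_pair => -[_ s1] ud.
  have := enorm_pair_snd (u - v) (s - t); rewrite distrC.
  by have := lerB_dist t s; move: k.+1%:R^-1 s1 => q; lra.
- move=> k l kl z [z1 zl]; split => //; apply: le_trans zl _.
  by rewrite lef_pV2 ?posrE// ler_nat.
- move=> k; have /existsNP[x /existsNP[u]] := unb k.+1.
  move=> /not_implyP[kx /not_implyP[nor /negP]]; rewrite -ltNge => ku.
  have u0 : 0 < enorm u by apply: le_lt_trans ku.
  have iu0 : 0 < (enorm u)^-1 by rewrite invr_gt0.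
  have iu : (enorm u)^-1 <= k.+1%:R^-1 by rewrite lef_pV2 ?posrE// ltW.
  have u1 : enorm ((enorm u)^-1 *: u) = 1.
    by rewrite enormZ gtr0_norm// mulVf// gt_eqF.
  have i1 : `|(enorm u)^-1 * -1| = (enorm u)^-1.
    by rewrite mulrN1 normrN gtr0_norm.
  exists x, (f x), ((enorm u)^-1 *: rV_pair u (-1)); split.
  + by apply: lt_trans kx; rewrite ltr_nat.
  + exact: regular_normal_coneZ.
  + by rewrite /P /= rV_pairZ lsubmx_pair rsubmx_pair i1.
  + rewrite rV_pairZ; apply: le_trans (enorm_pair_le _ _) _; rewrite u1 i1.
    have : (enorm u)^-1 <= 1.
      by apply: le_trans iu _; rewrite invf_le1// ler1n.
    by lra.
have [u [s zE]] := rV_pairP z.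
have {}Pz k : enorm u = 1 /\ `|s| <= k.+1%:R^-1.
  by have := Pz k; rewrite zE /P /= lsubmx_pair rsubmx_pair.
have s0 : s = 0.
  apply/eqP; rewrite -normr_le0; apply/ler_addgt0Pr => d d0; rewrite add0r.
  have [k kd] := filter_ex (near_infty_natSinv_lt (PosNum d0)).
  by have [_ sk] := Pz k; apply: le_trans sk (ltW kd).
have u0 : u = 0 by apply: sing0; rewrite /singular_subdiff_at_infinity /= -s0 -zE.
by have [/eqP] := Pz 0%N; rewrite u0 enorm0 eq_sym oner_eq0.
Qed.

Theorem proposition5p2 (R : realType) (n : nat) (hn : (0 < n)%N)
    (f : 'rV[R]_n -> R)
    (hf : lower_semicontinuous (fun x : 'rV[R]_n => (f x)%:E)) :
  (lipschitz_at_infinity f <->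
     singular_subdiff_at_infinity (fun x => (f x)%:E) = [set 0]) /\
  (lipschitz_at_infinity f ->
     subdiff_at_infinity (fun x => (f x)%:E) !=set0 /\
     compact (subdiff_at_infinity (fun x => (f x)%:E))).
Proof.
split; last first.
  move=> lipf; split; first exact: lipschitz_subdiff_at_infinity_nonempty.
  exact: lipschitz_subdiff_at_infinity_compact.
split=> [[L [rad [L0 _ fL]]]|sing0]; last first.
  by apply: singular_subdiff0_lipschitz => //; rewrite sing0.
apply/seteqP; split=> [u /(lipschitz_normal_at_infinity (ltW L0) fL)|_ ->].
  rewrite normr0 mulr0 => u0; apply/eqP.
  by rewrite -enorm_eq0 eq_le u0 enorm_ge0.
exact: singular_subdiff_at_infinity0.
Qed.
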